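(* Let $(\boldsymbol{\mathcal A}=\mathcal A[[\lambda]],\mu,I)$ be a $^*$-algebra deformation of a $^*$-algebra $\mathcal A$ over $\mathsf C$. Then taking the classical limit of $^*$-representations yields a functor $$\mathfrak C:{}^*\text{-}\mathsf{rep}(\boldsymbol{\mathcal A})\to{}^*\text{-}\mathsf{rep}(\mathcal A),$$ which maps strongly non-degenerate, filtered, and pseudo-cyclic $^*$-representations to strongly non-degenerate, filtered, and pseudo-cyclic $^*$-representations, respectively.
   Context: $\mathsf R$ is an ordered ring (commutative ring with $1\ne0$ and a subset $\mathsf P$ closed under sums and products such that $\mathsf R$ is the disjoint union $-\mathsf P\cup\{0\}\cup\mathsf P$), and $\mathsf C=\mathsf R(\mathrm i)$ with $\mathrm i^2=-1$ and the usual conjugation. $\mathsf R[[\lambda]]$ is an ordered ring: a non-zero $a=\sum_{r\ge r_0}\lambda^ra_r$ with $a_{r_0}\ne0$ is positive iff $a_{r_0}>0$; $\mathsf C[[\lambda]]=\mathsf R[[\lambda]](\mathrm i)$. $\mathfrak C$ applied to a formal power series is its zeroth order term. A $^*$-algebra over $\mathsf C$ is an associative $\mathsf C$-algebra with an antilinear involution satisfying $(AB)^*=B^*A^*$. A $^*$-algebra deformation of $\mathcal A$ is a $\mathsf C[[\lambda]]$-bilinear associative product $\mu=\sum_r\lambda^r\mu_r$ on $\mathcal A[[\lambda]]$ together with a $^*$-involution $I=\sum_r\lambda^rI_r$ for $\mu$ such that $\mu_0$ and $I_0$ are the given product and involution of $\mathcal A$. A pre-Hilbert space over $\mathsf C$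 (or $\mathsf C[[\lambda]]$) is a module with a Hermitian inner product (linear in the second argument), $\langle\phi,\phi\rangle\ge0$, and $\langle\phi,\phi\rangle=0\Rightarrow\phi=0$. A $^*$-representation is a $^*$-homomorphism into the adjointable endomorphisms of a pre-Hilbert space over the respective ring; ${}^*\text{-}\mathsf{rep}$ denotes the category of $^*$-representations with isometric (alternatively: adjointable, or unitary) intertwiners as morphisms (same choice on both sides). $(\mathfrak H,\pi)$ is strongly non-degenerate if the span of all $\pi(A)\phi$ is $\mathfrak H$. $\mathfrak H$ is filtered if $\mathfrak H=\bigcup_{\alpha\in I}\mathfrak H_\alpha$ with $I$ directed and submodules $\mathfrak H_\alpha\subseteq\mathfrak H_\beta$ for $\alpha\le\beta$; the representation is called filtered if it is compatible with such a filtration, $\pi(\mathcal A)\mathfrak H_\alpha\subseteq\mathfrak H_\alpha$. It is pseudo-cyclic if $\mathfrak H$ has a filtration (not necessarily compatible with $\pi$) and vectors $\Omega_\alpha\in\mathfrak H_\alpha$ such that every $\psi\in\mathfrak H_\alpha$ is of the form $\pi(A)\Omega_\alpha$. Classical limit: for a pre-Hilbert space $\boldsymbol{\mathfrak H}$ over $\mathsf C[[\lambda]]$ put $\boldsymbol{\mathfrak H}_L=\{\phi\mid\mathfrak C\langle\phi,\psi\rangle=0\ \forall\psi\}$ and $\mathfrak C\boldsymbol{\mathfrak H}=\boldsymbol{\mathfrak H}/\boldsymbol{\mathfrak H}_L$, with projection $\mathfrak C:\boldsymbol{\mathfrak H}\to\mathfrak C\boldsymbol{\mathfrak H}$, regarded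 as a pre-Hilbert space over $\mathsf C$ with $\langle\mathfrak C\phi,\mathfrak C\psi\rangle=\mathfrak C\langle\phi,\psi\rangle$. A $^*$-representation $(\boldsymbol{\mathfrak H},\boldsymbol\pi)$ of $\boldsymbol{\mathcal A}$ is sent to $\mathfrak C\boldsymbol\pi$ on $\mathfrak C\boldsymbol{\mathfrak H}$, $(\mathfrak C\boldsymbol\pi)(\mathfrak CA)\,\mathfrak C\phi=\mathfrak C(\boldsymbol\pi(A)\phi)$ for $A\in\boldsymbol{\mathcal A}$, and a morphism $\boldsymbol T$ to $\mathfrak C\boldsymbol T$, $(\mathfrak C\boldsymbol T)\mathfrak C\phi=\mathfrak C(\boldsymbol T\phi)$. *)

(* Defs.v *)
From HB Require Import structures.
From mathcomp Require Import all_boot all_order all_algebra ring_quotient ring zify.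
From mathcomp Require Import boolp classical_sets.

Set Implicit Arguments.
Unset Strict Implicit.
Unset Printing Implicit Defensive.

Import Order.TTheory GRing.Theory Num.Theory.

Local Open Scope ring_scope.
Local Open Scope classical_set_scope.

(* An ordered ring is rendered as a [realDomainType]: the trichotomy of the    *)
(* positive cone makes an ordered ring an integral domain with a total order,  *)
(* and the remaining data (inverses of units, choice) exist classically.       *)

(** * The ring R(i) *)

(* mathcomp-real-closed has a ring structure on [R[i]] only over a field, and  *)
(* R[[lambda]] is never one.                                                   *)
Record Cx (R : Type) : Type := MkCx { re : R; im : R }.

Section CxRing.
Variable R : comNzRingType.
Implicit Types x y z : Cx R.

Definition Cx_pair x := (re x, im x).
Definition pair_Cx (p : R * R) := MkCx p.1 p.2.
Lemma Cx_pairK : cancel Cx_pair pair_Cx. Proof. by case. Qed.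
HB.instance Definition _ := Equality.copy (Cx R) (can_type Cx_pairK).
HB.instance Definition _ := Choice.copy (Cx R) (can_type Cx_pairK).

Lemma CxP x y : re x = re y -> im x = im y -> x = y.
Proof. by case: x y => [a b] [c d] /= -> ->. Qed.

Definition Cx_zero : Cx R := MkCx 0 0.
Definition Cx_one : Cx R := MkCx 1 0.
Definition Cx_opp x := MkCx (- re x) (- im x).
Definition Cx_add x y := MkCx (re x + re y) (im x + im y).
Definition Cx_mul x y :=
  MkCx (re x * re y - im x * im y) (re x * im y + im x * re y).

Lemma Cx_addA : associative Cx_add.
Proof. by move=> x y z; apply: CxP => /=; rewrite addrA. Qed.
Lemma Cx_addC : commutative Cx_add.
Proof. by move=> x y; apply: CxP => /=; rewrite addrC. Qed.
Lemma Cx_add0 : left_id Cx_zero Cx_add.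
Proof. by move=> x; apply: CxP => /=; rewrite add0r. Qed.
Lemma Cx_addN : left_inverse Cx_zero Cx_opp Cx_add.
Proof. by move=> x; apply: CxP => /=; rewrite addNr. Qed.
HB.instance Definition _ :=
  GRing.isZmodule.Build (Cx R) Cx_addA Cx_addC Cx_add0 Cx_addN.

Lemma Cx_mulA : associative Cx_mul.
Proof.
by move=> x y z; apply: CxP => /=; ring.
Qed.
Lemma Cx_mulC : commutative Cx_mul.
Proof.
by move=> x y; apply: CxP => /=; ring.
Qed.
Lemma Cx_mul1 : left_id Cx_one Cx_mul.
Proof. by move=> x; apply: CxP => /=; rewrite !mul1r mul0r ?subr0 ?addr0. Qed.
Lemma Cx_mulD : left_distributive Cx_mul Cx_add.
Proof.
by move=> x y z; apply: CxP => /=; ring.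
Qed.
Lemma Cx_one0 : Cx_one != 0.
Proof. by apply/eqP => -[/eqP]; rewrite oner_eq0. Qed.
HB.instance Definition _ := GRing.Zmodule_isComNzRing.Build (Cx R)
  Cx_mulA Cx_mulC Cx_mul1 Cx_mulD Cx_one0.

Definition conj x : Cx R := MkCx (re x) (- im x).

End CxRing.

Definition Cx_ge0 (R : realDomainType) (z : Cx R) : Prop :=
  im z = 0 /\ 0 <= re z.

(** * Formal power series *)

Record fps (T : Type) : Type := MkFps { coef : nat -> T }.

Lemma fpsP (T : Type) (x y : fps T) : coef x =1 coef y -> x = y.
Proof. by case: x y => [f] [g] /= fg; congr MkFps; apply: funext. Qed.

HB.instance Definition _ (T : Type) := gen_eqMixin (fps T).
HB.instance Definition _ (T : Type) := gen_choiceMixin (fps T).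

Section FpsZmod.
Variable V : zmodType.
Implicit Types x y : fps V.

Definition fps_zero : fps V := MkFps (fun=> 0).
Definition fps_opp x := MkFps (fun n => - coef x n).
Definition fps_add x y := MkFps (fun n => coef x n + coef y n).

Lemma fps_addA : associative fps_add.
Proof. by move=> x y z; apply: fpsP => n /=; rewrite addrA. Qed.
Lemma fps_addC : commutative fps_add.
Proof. by move=> x y; apply: fpsP => n /=; rewrite addrC. Qed.
Lemma fps_add0 : left_id fps_zero fps_add.
Proof. by move=> x; apply: fpsP => n /=; rewrite add0r. Qed.
Lemma fps_addN : left_inverse fps_zero fps_opp fps_add.
Proof. by move=> x; apply: fpsP => n /=; rewrite addNr. Qed.
HB.instance Definition _ :=
  GRing.isZmodule.Build (fps V) fps_addA fps_addC fps_add0 fps_addN.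

Lemma coef0E n : coef (0 : fps V) n = 0. Proof. by []. Qed.
Lemma coefDE x y n : coef (x + y) n = coef x n + coef y n. Proof. by []. Qed.
Lemma coefNE x n : coef (- x) n = - coef x n. Proof. by []. Qed.
Lemma coefBE x y n : coef (x - y) n = coef x n - coef y n. Proof. by []. Qed.

(* The constant series. *)
Definition fps_const (v : V) : fps V := MkFps (fun n => if n is 0 then v else 0).

End FpsZmod.

(* The lambda-linear extension of a biadditive map to power series. *)
Definition conv (U V W : zmodType) (op : U -> V -> W) (x : fps U) (y : fps V) :
    fps W :=
  MkFps (fun n => \sum_(i < n.+1) op (coef x i) (coef y (n - i))).

Section Conv.

Lemma sum_triangle (W : zmodType) (G : nat -> nat -> W) n :
  \sum_(k < n.+1) \sum_(i < k.+1) G i (k - i)%N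
  = \sum_(i < n.+1) \sum_(j < (n - i).+1) G i j.
Proof.
elim: n => [|n IH]; first by rewrite !big_ord1.
rewrite big_ord_recr /= IH [RHS]big_ord_recr /= subnn big_ord1.
rewrite [X in _ + X = _]big_ord_recr /= subnn addrA; congr (_ + _).
rewrite -big_split /=; apply: eq_bigr => i _.
by rewrite subSn ?[RHS]big_ord_recr //= -ltnS.
Qed.

Lemma convA (U V W X Y Z : zmodType) (o1 : U -> Y -> Z) (o2 : V -> W -> Y)
    (o3 : X -> W -> Z) (o4 : U -> V -> X) x y z :
  (forall a, {morph o1 a : u v / u + v}) -> (forall a, o1 a 0 = 0) ->
  (forall b, {morph o3^~ b : u v / u + v}) -> (forall b, o3 0 b = 0) ->
  (forall a b c, o1 a (o2 b c) = o3 (o4 a b) c) ->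
  conv o1 x (conv o2 y z) = conv o3 (conv o4 x y) z.
Proof.
move=> D1 Z1 D3 Z3 A; apply: fpsP => n /=.
pose G i j := o3 (o4 (coef x i) (coef y j)) (coef z (n - i - j)).
transitivity (\sum_(i < n.+1) \sum_(j < (n - i).+1) G i j).
  apply: eq_bigr => i _; rewrite (big_morph _ (D1 _) (Z1 _)).
  by apply: eq_bigr => j _; rewrite A.
rewrite -sum_triangle; apply: eq_bigr => k _.
rewrite (big_morph (o3^~ _) (D3 _) (Z3 _)); apply: eq_bigr => i _.
by rewrite /G -subnDA subnKC // -ltnS.
Qed.

Lemma convC (U V W : zmodType) (o : U -> V -> W) (o' : V -> U -> W) x y :
  (forall a b, o a b = o' b a) -> conv o x y = conv o' y x.
Proof.
move=> C; apply: fpsP => n /=; rewrite (reindex_inj rev_ord_inj) /=.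
apply: eq_bigr => i _; rewrite C subSS subKn // -ltnS //.
Qed.

Lemma convDl (U V W : zmodType) (o : U -> V -> W) x x' y :
  (forall b, {morph o^~ b : u v / u + v}) ->
  conv o (x + x') y = conv o x y + conv o x' y.
Proof.
move=> D; apply: fpsP => n /=; rewrite -big_split.
by apply: eq_bigr => i _; rewrite D.
Qed.

Lemma convDr (U V W : zmodType) (o : U -> V -> W) x y y' :
  (forall a, {morph o a : u v / u + v}) ->
  conv o x (y + y') = conv o x y + conv o x y'.
Proof.
move=> D; apply: fpsP => n /=; rewrite -big_split.
by apply: eq_bigr => i _; rewrite D.
Qed.

Lemma conv_constl (U V W : zmodType) (o : U -> V -> W) u y :
  (forall b, o 0 b = 0) ->
  conv o (fps_const u) y = MkFps (fun n => o u (coef y n)).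
Proof.
move=> Z; apply: fpsP => n /=; rewrite big_ord_recl /= subn0.
by rewrite big1 ?addr0 // => i _; rewrite Z.
Qed.

End Conv.

Section FpsRing.
Variable R : comNzRingType.
Implicit Types x y : fps R.

Definition fps_one : fps R := fps_const 1.
Definition fps_mul x y : fps R := conv *%R x y.

Lemma fps_mulA : associative fps_mul.
Proof.
move=> x y z; apply: convA; first exact: mulrDr.
- exact: mulr0.
- by move=> b u v; rewrite mulrDl.
- exact: mul0r.
- exact: mulrA.
Qed.
Lemma fps_mulC : commutative fps_mul.
Proof. by move=> x y; apply: convC; exact: mulrC. Qed.
Lemma fps_mul1 : left_id fps_one fps_mul.
Proof.
move=> x; rewrite /fps_mul conv_constl; last exact: mul0r.
by apply: fpsP => n /=; rewrite mul1r.
Qed.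
Lemma fps_mulD : left_distributive fps_mul +%R.
Proof. by move=> x y z; apply: convDl => b u v; rewrite mulrDl. Qed.
Lemma fps_one0 : fps_one != 0.
Proof.
by apply/eqP => /(congr1 (@coef R)) /(congr1 (@^~ 0%N)) /= /eqP; rewrite oner_eq0.
Qed.
HB.instance Definition _ := GRing.Zmodule_isComNzRing.Build (fps R)
  fps_mulA fps_mulC fps_mul1 fps_mulD fps_one0.

Lemma coefME x y n :
  coef (x * y) n = \sum_(i < n.+1) coef x i * coef y (n - i).
Proof. by []. Qed.

Definition fps_unit : pred (fps R) := fun x => `[< exists y, y * x = 1 >].
Definition fps_inv x : fps R := xget x [set y | y * x = 1].

Lemma fps_mulVx : {in fps_unit, left_inverse 1 fps_inv *%R}.
Proof.
move=> x /asboolP ux; rewrite /fps_inv; case: xgetP => [y _ //|none].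
by case: ux => y yx; case: (none y).
Qed.
Lemma fps_unitPl x y : y * x = 1 -> fps_unit x.
Proof. by move=> yx; apply/asboolP; exists y. Qed.
Lemma fps_invr_out : {in [predC fps_unit], fps_inv =1 id}.
Proof.
move=> x /asboolP nux; rewrite /fps_inv; case: xgetP => // y _ yx.
by case: nux; exists y.
Qed.
HB.instance Definition _ := GRing.ComNzRing_hasMulInverse.Build (fps R)
  fps_mulVx fps_unitPl fps_invr_out.

End FpsRing.

Section FpsOrder.
Variable R : realDomainType.
Implicit Types x y z : fps R.

Definition lowest x r :=
  (forall s, (s < r)%N -> coef x s = 0) /\ coef x r != 0.

Lemma lowest_ex x : x != 0 -> exists r, lowest x r.
Proof.
move=> x0; have ex : exists n, coef x n != 0.
  apply: contrapT => /forallNP h; case/eqP: x0; apply: fpsP => n /=.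
  by apply/eqP; case: eqP (h n) => // _ [].
exists (ex_minn ex); case: ex_minnP => r xr rm; split=> // s sr.
by apply/eqP; apply: contraTT sr => /rm; rewrite -leqNgt.
Qed.

Lemma lowest_mul x y r s :
  (forall i, (i < r)%N -> coef x i = 0) -> (forall i, (i < s)%N -> coef y i = 0) ->
  (forall i, (i < r + s)%N -> coef (x * y) i = 0) /\
  coef (x * y) (r + s) = coef x r * coef y s.
Proof.
move=> xr ys; split=> [n nrs|].
  rewrite coefME big1 // => i _; case: (ltnP i r) => ir; first by rewrite xr ?mul0r.
  by rewrite [X in _ * X]ys ?mulr0 //; have := ltn_ord i; lia.
have lr : (r < (r + s).+1)%N by rewrite ltnS leq_addr.
rewrite coefME (bigD1 (Ordinal lr)) //= addKn big1 ?addr0 // => i ne.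
case: (ltngtP i r) => ir; first by rewrite xr ?mul0r.
  by rewrite [X in _ * X]ys ?mulr0 //; have := ltn_ord i; lia.
by case/eqP: ne; apply: val_inj.
Qed.

Lemma fps_idomain x y : x * y = 0 -> (x == 0) || (y == 0).
Proof.
move=> xy; apply/orP; case: (boolP (x == 0)) => [_|/lowest_ex[r [rx x0]]].
  by left.
case: (boolP (y == 0)) => [_|/lowest_ex[s [sy y0]]]; first by right.
have [_] := lowest_mul rx sy; rewrite xy coef0E => /esym/eqP.
by rewrite mulf_eq0 (negbTE x0) (negbTE y0).
Qed.
HB.instance Definition _ := GRing.ComUnitRing_isIntegral.Build (fps R) fps_idomain.

Definition fps_pos x : Prop :=
  exists r, (forall s, (s < r)%N -> coef x s = 0) /\ 0 < coef x r.
Definition fps_lt x y : bool := `[< fps_pos (y - x) >].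
Definition fps_le x y : bool := (x == y) || fps_lt x y.
Definition fps_norm x : fps R := if fps_lt x 0 then - x else x.

Lemma fps_lt0_add x y : fps_lt 0 x -> fps_lt 0 y -> fps_lt 0 (x + y).
Proof.
rewrite /fps_lt !subr0 => /asboolP[r [rx xr]] /asboolP[s [sy ys]]; apply/asboolP.
case: (ltngtP r s) => rs.
- exists r; split=> [t tr|]; rewrite coefDE.
    by rewrite rx // sy ?addr0 // (ltn_trans tr).
  by rewrite sy ?addr0.
- exists s; split=> [t ts|]; rewrite coefDE.
    by rewrite sy // rx ?addr0 // (ltn_trans ts).
  by rewrite rx ?add0r.
- exists r; rewrite -rs in sy ys.
  by split=> [t tr|]; rewrite coefDE ?addr_gt0 // rx ?sy ?addr0.
Qed.

Lemma fps_lt0_mul x y : fps_lt 0 x -> fps_lt 0 y -> fps_lt 0 (x * y).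
Proof.
rewrite /fps_lt !subr0 => /asboolP[r [rx xr]] /asboolP[s [sy ys]]; apply/asboolP.
have [h1 h2] := lowest_mul rx sy.
by exists (r + s)%N; rewrite h2 mulr_gt0.
Qed.

Lemma fps_lt0_ngt0 x : fps_lt 0 x -> ~~ fps_lt x 0.
Proof.
rewrite /fps_lt subr0 sub0r => /asboolP[r [rx xr]]; apply/asboolP => -[s [sy ys]].
rewrite coefNE oppr_gt0 in ys.
case: (ltngtP r s) => rs.
- by move: (sy _ rs) xr; rewrite coefNE => /eqP; rewrite oppr_eq0 => /eqP->; rewrite ltxx.
- by move: ys; rewrite rx ?ltxx.
- by move: ys; rewrite -rs ltNge ltW.
Qed.

Lemma fps_sub_gt0 x y : fps_lt 0 (y - x) = fps_lt x y.
Proof. by rewrite /fps_lt subr0. Qed.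

Lemma fps_lt0_total x : x != 0 -> fps_lt 0 x || fps_lt x 0.
Proof.
case/lowest_ex => r [rx xr]; rewrite /fps_lt subr0 sub0r; apply/orP.
case: (ltgtP 0 (coef x r)) => h.
- by left; apply/asboolP; exists r.
- right; apply/asboolP; exists r; rewrite coefNE oppr_gt0; split=> // s /rx.
  by rewrite coefNE => ->; rewrite oppr0.
- by rewrite -h eqxx in xr.
Qed.

Lemma fps_normN x : fps_norm (- x) = fps_norm x.
Proof.
have e : fps_lt (- x) 0 = fps_lt 0 x by rewrite /fps_lt sub0r opprK subr0.
rewrite /fps_norm e opprK; case: (eqVneq x 0) => [->|x0].
  by rewrite oppr0; case: ifP.
have := fps_lt0_total x0; case: ifP => [/fps_lt0_ngt0/negbTE->//|_ /= ->//].
Qed.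

Lemma fps_ge0_norm x : fps_le 0 x -> fps_norm x = x.
Proof.
rewrite /fps_norm; case/orP => [/eqP<-|/fps_lt0_ngt0/negbTE->//].
by rewrite oppr0; case: ifP.
Qed.

HB.instance Definition _ := Num.IntegralDomain_isLtReal.Build (fps R)
  fps_lt0_add fps_lt0_mul fps_lt0_ngt0 fps_sub_gt0 fps_lt0_total
  fps_normN fps_ge0_norm (fun _ _ => erefl).

End FpsOrder.

(* The isomorphism R[[lambda]](i) = C[[lambda]], coefficientwise. *)
Definition ccoef (R : Type) (z : Cx (fps R)) (n : nat) : Cx R :=
  MkCx (coef (re z) n) (coef (im z) n).

(* The zeroth order term of an element of C[[lambda]]. *)
Definition clim (R : Type) (z : Cx (fps R)) : Cx R := ccoef z 0.

Definition Cconst (R : zmodType) (z : Cx R) : Cx (fps R) :=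
  MkCx (fps_const (re z)) (fps_const (im z)).

Section FpsModule.
Variables (R : comNzRingType) (V : lmodType (Cx R)).

Definition fps_of_Cx (z : Cx (fps R)) : fps (Cx R) := MkFps (ccoef z).

Lemma re_sum I r (P : pred I) (F : I -> Cx R) :
  re (\sum_(i <- r | P i) F i) = \sum_(i <- r | P i) re (F i).
Proof. by elim/big_rec2: _ => //= i x y _ <-. Qed.
Lemma im_sum I r (P : pred I) (F : I -> Cx R) :
  im (\sum_(i <- r | P i) F i) = \sum_(i <- r | P i) im (F i).
Proof. by elim/big_rec2: _ => //= i x y _ <-. Qed.

Lemma fps_of_CxM (z w : Cx (fps R)) :
  fps_of_Cx (z * w) = conv *%R (fps_of_Cx z) (fps_of_Cx w).
Proof.
apply: fpsP => n /=; apply: CxP; rewrite ?re_sum ?im_sum /= ?big_split //=.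
by rewrite sumrN.
Qed.

Lemma fps_of_CxD (z w : Cx (fps R)) :
  fps_of_Cx (z + w) = fps_of_Cx z + fps_of_Cx w.
Proof. by apply: fpsP. Qed.

Lemma fps_of_CxC (z : Cx R) : fps_of_Cx (Cconst z) = fps_const z.
Proof. by case: z => a b; apply: fpsP => -[|n]. Qed.

Definition fps_scale (z : Cx (fps R)) (v : fps V) : fps V :=
  conv *:%R (fps_of_Cx z) v.

Lemma fps_scaleA z w v : fps_scale z (fps_scale w v) = fps_scale (z * w) v.
Proof.
rewrite /fps_scale fps_of_CxM; apply: convA.
- exact: scalerDr.
- exact: scaler0.
- by move=> b x y; rewrite scalerDl.
- exact: scale0r.
- exact: scalerA.
Qed.
Lemma fps_scale1 : left_id 1 fps_scale.
Proof.
move=> v; rewrite /fps_scale.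
have -> : fps_of_Cx 1 = fps_const 1 by apply: fpsP => -[|n].
rewrite conv_constl; last exact: scale0r.
by apply: fpsP => n /=; rewrite scale1r.
Qed.
Lemma fps_scaleDr : right_distributive fps_scale +%R.
Proof. by move=> z v w; apply: convDr => a; exact: scalerDr. Qed.
Lemma fps_scaleDl v : {morph fps_scale^~ v : z w / z + w}.
Proof.
by move=> z w; rewrite /fps_scale fps_of_CxD convDl // => b x y; rewrite scalerDl.
Qed.
HB.instance Definition _ := GRing.Zmodule_isLmodule.Build (Cx (fps R)) (fps V)
  fps_scaleA fps_scale1 fps_scaleDr fps_scaleDl.

End FpsModule.

(** * Star-algebras and their deformations *)

(* No unit is required. *)
Record is_star_algebra (R : realDomainType) (V : lmodType (Cx R))
    (mul : V -> V -> V) (star : V -> V) : Prop := IsStarAlgebra {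
  sa_linl : forall c a b d, mul (c *: a + b) d = c *: mul a d + mul b d;
  sa_linr : forall c a b d, mul d (c *: a + b) = c *: mul d a + mul d b;
  sa_assoc : associative mul;
  sa_antilin : forall c a b, star (c *: a + b) = conj c *: star a + star b;
  sa_invol : involutive star;
  sa_antimul : forall a b, star (mul a b) = mul (star b) (star a)
}.

Record starAlg (R : realDomainType) := StarAlg {
  sa_mod :> lmodType (Cx R);
  sa_mul : sa_mod -> sa_mod -> sa_mod;
  sa_star : sa_mod -> sa_mod;
  sa_axioms : is_star_algebra sa_mul sa_star
}.

(* sum_r lambda^r mu_r, extended lambda-linearly to series in both arguments. *)
Definition series_mul (V : zmodType) (mu : nat -> V -> V -> V) (f g : fps V) :
    fps V :=
  MkFps (fun n => \sum_(r < n.+1) coef (conv (mu r) f g) (n - r)).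

Definition series_map (V : zmodType) (I : nat -> V -> V) (f : fps V) : fps V :=
  MkFps (fun n => \sum_(r < n.+1) I r (coef f (n - r))).

Record deformation (R : realDomainType) (A : starAlg R) := Deformation {
  def_mu : nat -> A -> A -> A;
  def_I : nat -> A -> A;
  def_axioms : is_star_algebra (R := fps R) (V := fps A)
                 (series_mul def_mu) (series_map def_I);
  def_mu0 : forall a b, def_mu 0 a b = sa_mul a b;
  def_I0 : forall a, def_I 0 a = sa_star a
}.

Definition def_alg (R : realDomainType) (A : starAlg R) (D : deformation A) :
  starAlg (fps R) := StarAlg (def_axioms D).

Definition clim_alg (R : realDomainType) (A : starAlg R) (D : deformation A)
  (a : def_alg D) : A := coef (a : fps A) 0.

(** * Pre-Hilbert spaces and star-representations *)

Record preHilbert (R : realDomainType) := PreHilbert {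
  ph_mod :> lmodType (Cx R);
  ip : ph_mod -> ph_mod -> Cx R;
  ip_linr : forall c x y z, ip z (c *: x + y) = c * ip z x + ip z y;
  ip_herm : forall x y, ip y x = conj (ip x y);
  ip_ge0 : forall x, Cx_ge0 (ip x x);
  ip_def : forall x, ip x x = 0 -> x = 0
}.

Definition adjoint_of (R : realDomainType) (H K : preHilbert R)
    (T : {linear H -> K}) (S : {linear K -> H}) : Prop :=
  forall x y, ip (S y) x = ip y (T x).

(* A star-homomorphism into the adjointable endomorphisms of H: by [rep_star],  *)
(* every [rep_act a] is adjointable and its adjoint is [rep_act (sa_star a)].   *)
Record starRep (R : realDomainType) (A : starAlg R) (H : preHilbert R) :=
  StarRep {
  rep_act :> A -> {linear H -> H};
  rep_lin : forall c a b x, rep_act (c *: a + b) x = c *: rep_act a x + rep_act b x;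
  rep_mul : forall a b x, rep_act (sa_mul a b) x = rep_act a (rep_act b x);
  rep_star : forall a, adjoint_of (rep_act a) (rep_act (sa_star a))
}.

(** * The categories of star-representations *)

Record category := Category {
  ob :> Type;
  hom : ob -> ob -> Type;
  idm : forall X, hom X X;
  comp : forall X Y Z, hom Y Z -> hom X Y -> hom X Z;
  comp_idl : forall X Y (f : hom X Y), comp (idm Y) f = f;
  comp_idr : forall X Y (f : hom X Y), comp f (idm X) = f;
  comp_assoc : forall X Y Z W (f : hom Z W) (g : hom Y Z) (h : hom X Y),
    comp f (comp g h) = comp (comp f g) h
}.

Definition is_functor (C D : category) (fob : C -> D)
    (fmap : forall X Y : C, hom X Y -> hom (fob X) (fob Y)) : Prop :=
  (forall X, fmap X X (idm X) = idm (fob X)) /\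
  (forall X Y Z (f : hom Y Z) (g : hom X Y),
     fmap X Z (comp f g) = comp (fmap Y Z f) (fmap X Y g)).

Variant morphism_kind := Isometric | Adjointable | Unitary.

Definition of_kind (k : morphism_kind) (R : realDomainType) (H K : preHilbert R)
    (T : {linear H -> K}) : Prop :=
  match k with
  | Isometric => forall x y, ip (T x) (T y) = ip x y
  | Adjointable => exists S : {linear K -> H}, adjoint_of T S
  | Unitary => exists S : {linear K -> H},
      [/\ adjoint_of T S, cancel T S & cancel S T]
  end.

Record repr_ob (R : realDomainType) (A : starAlg R) := ReprOb {
  rob_space : preHilbert R;
  rob_rep : starRep A rob_space
}.

Record intertwiner (k : morphism_kind) (R : realDomainType) (A : starAlg R)
    (X Y : repr_ob A) := Intertwiner {
  int_map :> {linear rob_space X -> rob_space Y};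
  int_comm : forall a x, int_map (rob_rep X a x) = rob_rep Y a (int_map x);
  int_kind : of_kind k int_map
}.

Lemma linear_inj (R : pzRingType) (U V : lmodType R) (f g : {linear U -> V}) :
  (f : U -> V) = g -> f = g.
Proof.
case: f g => [f [[f1] [f2]]] [g [[g1] [g2]]] /= fg; subst g.
by rewrite (Prop_irrelevance f1 g1) (Prop_irrelevance f2 g2).
Qed.

Section RepCategory.
Variables (k : morphism_kind) (R : realDomainType) (A : starAlg R).

Lemma intertwiner_inj (X Y : repr_ob A) (S T : intertwiner k X Y) :
  S =1 T -> S = T.
Proof.
case: S T => [S cS kS] [T cT kT] /= /funext/linear_inj ST; subst T.
by rewrite (Prop_irrelevance cS cT) (Prop_irrelevance kS kT).
Qed.

Lemma of_kind_id (H : preHilbert R) : of_kind k (idfun : {linear H -> H}).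
Proof. by case: k => //=; exists (idfun : {linear H -> H}). Qed.

Lemma of_kind_comp (H K L : preHilbert R) (S : {linear K -> L})
    (T : {linear H -> K}) :
  of_kind k S -> of_kind k T -> of_kind k (S \o T : {linear H -> L}).
Proof.
case: k => /=.
- by move=> hS hT x y; rewrite hS hT.
- move=> [S' hS] [T' hT]; exists (T' \o S' : {linear L -> H}) => x y /=.
  by rewrite hT hS.
- move=> [S' [hS S1 S2]] [T' [hT T1 T2]].
  exists (T' \o S' : {linear L -> H}); split=> [x y|x|x] /=.
  + by rewrite hT hS.
  + by rewrite S1 T1.
  + by rewrite T2 S2.
Qed.

Definition int_id (X : repr_ob A) : intertwiner k X X :=
  @Intertwiner k R A X X idfun (fun _ _ => erefl) (of_kind_id _).

Lemma int_comp_comm (X Y Z : repr_ob A) (S : intertwiner k Y Z)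
    (T : intertwiner k X Y) a x :
  (S \o T) (rob_rep X a x) = rob_rep Z a ((S \o T) x).
Proof. by rewrite /= !int_comm. Qed.

Definition int_comp (X Y Z : repr_ob A) (S : intertwiner k Y Z)
    (T : intertwiner k X Y) : intertwiner k X Z :=
  @Intertwiner k R A X Z (S \o T) (int_comp_comm S T)
    (of_kind_comp (int_kind S) (int_kind T)).

Definition rep_cat : category.
Proof.
refine (@Category (repr_ob A) (@intertwiner k R A) int_id int_comp _ _ _).
- by move=> X Y f; apply: intertwiner_inj.
- by move=> X Y f; apply: intertwiner_inj.
- by move=> X Y Z W f g h; apply: intertwiner_inj.
Defined.

End RepCategory.

(** * Properties of star-representations *)

Definition is_submodule (R : pzRingType) (V : lmodType R) (S : set V) : Prop :=
  S 0 /\ forall c x y, S x -> S y -> S (c *: x + y).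

Definition span (R : pzRingType) (V : lmodType R) (S : set V) : set V :=
  [set x | exists n (c : 'I_n -> R) (v : 'I_n -> V),
     (forall i, S (v i)) /\ x = \sum_(i < n) c i *: v i].

Record filtration (R : pzRingType) (V : lmodType R) := Filtration {
  fil_idx : Type;
  fil_le : fil_idx -> fil_idx -> Prop;
  fil_refl : forall i, fil_le i i;
  fil_trans : forall i j l, fil_le i j -> fil_le j l -> fil_le i l;
  fil_directed : forall i j, exists l, fil_le i l /\ fil_le j l;
  fil_piece :> fil_idx -> set V;
  fil_submodule : forall i, is_submodule (fil_piece i);
  fil_mono : forall i j, fil_le i j -> fil_piece i `<=` fil_piece j;
  fil_cover : \bigcup_i fil_piece i = setT
}.

Section RepProperties.
Variables (R : realDomainType) (A : starAlg R) (H : preHilbert R).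
Variable pi : starRep A H.

Definition strongly_nondegenerate : Prop :=
  span [set x | exists a phi, x = pi a phi] = setT.

Definition compatible (F : filtration H) : Prop :=
  forall i a phi, F i phi -> F i (pi a phi).

(* The one-piece filtration is always compatible; the content of preserving     *)
(* filtered representations is that [cl_filtration] preserves compatibility.    *)
Definition filtered : Prop := exists F : filtration H, compatible F.

Definition pseudo_cyclic_vectors (F : filtration H) (Omega : fil_idx F -> H) :
    Prop :=
  forall i, F i (Omega i) /\ forall psi, F i psi -> exists a, psi = pi a (Omega i).

Definition pseudo_cyclic : Prop :=
  exists (F : filtration H) (Omega : fil_idx F -> H), pseudo_cyclic_vectors Omega.

End RepProperties.

(** * The classical limit of a pre-Hilbert space *)

Section InnerProduct.
Variables (R : realDomainType) (H : preHilbert R).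
Implicit Types x y z : H.

Lemma ipDr z x y : ip z (x + y) = ip z x + ip z y.
Proof. by have := ip_linr 1 x y z; rewrite scale1r mul1r. Qed.
Lemma ip0r z : ip z 0 = 0.
Proof. by apply: (addIr (ip z 0)); rewrite add0r -ipDr addr0. Qed.
Lemma ipZr c z x : ip z (c *: x) = c * ip z x.
Proof. by have := ip_linr c x 0 z; rewrite !addr0 ip0r addr0. Qed.
Lemma ipNr z x : ip z (- x) = - ip z x.
Proof. by rewrite -scaleN1r ipZr mulN1r. Qed.
Lemma ipDl z x y : ip (x + y) z = ip x z + ip y z.
Proof.
rewrite (ip_herm z (x + y)) ipDr (ip_herm z x) (ip_herm z y).
by apply: CxP => //=; rewrite opprD.
Qed.
Lemma ip0l z : ip 0 z = 0.
Proof. by rewrite (ip_herm z) ip0r; apply: CxP => //=; rewrite oppr0. Qed.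
Lemma ipNl z x : ip (- x) z = - ip x z.
Proof. by apply: (addIr (ip x z)); rewrite -ipDl !addNr ip0l. Qed.
Lemma ipZl c z x : ip (c *: x) z = conj c * ip x z.
Proof.
rewrite (ip_herm z) ipZr (ip_herm z x).
by apply: CxP => /=; ring.
Qed.

End InnerProduct.

(* A null vector of the semidefinite form clim <.,.> is orthogonal to H. As R  *)
(* need be neither archimedean nor a field, test on -(q+1) b x + |b|^2 y.       *)
Lemma cs_algebra (R : realDomainType) (b : Cx R) (q : R) : 0 <= q ->
  let s := re b ^+ 2 + im b ^+ 2 in
  let c := MkCx (- (q + 1)) 0 * b in
  let d := MkCx s 0 in
  0 <= re (conj c * (d * b) + conj d * (c * conj b) + conj d * (d * MkCx q 0)) ->
  b = 0.
Proof.
move=> q0; case: b => b1 b2 /=; set X := (X in 0 <= X).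
have -> : X = - ((b1 ^+ 2 + b2 ^+ 2) ^+ 2 * (q + 2%:R)) by rewrite /X; ring.
rewrite oppr_ge0 pmulr_lle0; last by rewrite ltr_wpDl.
move=> s2; have : (b1 ^+ 2 + b2 ^+ 2) ^+ 2 == 0.
  by apply/eqP/le_anti; rewrite s2 sqr_ge0.
rewrite sqrf_eq0 paddr_eq0 ?sqr_ge0 // !sqrf_eq0 => /andP[/eqP h1 /eqP h2].
exact: CxP.
Qed.

Section ClassicalLimitSpace.
Variables (R : realDomainType) (H : preHilbert (fps R)).
Implicit Types phi psi : H.

Lemma climD (z w : Cx (fps R)) : clim (z + w) = clim z + clim w.
Proof. by []. Qed.
Lemma climB (z w : Cx (fps R)) : clim (z - w) = clim z - clim w.
Proof. by []. Qed.
Lemma climM (z w : Cx (fps R)) : clim (z * w) = clim z * clim w.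
Proof. by apply: CxP; rewrite /= !big_ord1. Qed.
Lemma clim_conj (z : Cx (fps R)) : clim (conj z) = conj (clim z).
Proof. by []. Qed.
Lemma clim_const (z : Cx R) : clim (Cconst z) = z.
Proof. by case: z. Qed.
Lemma Cconst_conj (z : Cx R) : conj (Cconst z) = Cconst (conj z).
Proof. by apply: CxP => //=; apply: fpsP => -[|n] //=; rewrite oppr0. Qed.

Definition null_space : {pred H} :=
  fun phi => `[< forall psi, clim (ip phi psi) = 0 >].

Lemma null_spaceP phi :
  reflect (forall psi, clim (ip phi psi) = 0) (phi \in null_space).
Proof. exact: asboolP. Qed.

Lemma null_zmod_closed : zmod_closed null_space.
Proof.
split; first by apply/null_spaceP => psi; rewrite ip0l.
move=> x y /null_spaceP hx /null_spaceP hy; apply/null_spaceP => psi.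
by rewrite ipDl ipNl climB hx hy subr0.
Qed.
HB.instance Definition _ := GRing.isZmodClosed.Build H null_space null_zmod_closed.

Definition cl_space : Type := Quotient.quot null_space.
HB.instance Definition _ := GRing.Zmodule.on cl_space.

Definition cl_proj (phi : H) : cl_space := \pi_(Quotient.quot null_space)%qT phi.
Definition cl_repr (u : cl_space) : H := repr (u : (Quotient.quot null_space)).

Lemma cl_reprK : cancel cl_repr cl_proj.
Proof. by move=> u; rewrite /cl_proj /cl_repr reprK. Qed.

Lemma cl_projP phi psi : cl_proj phi = cl_proj psi <-> phi - psi \in null_space.
Proof.
by split=> [/eqP|h]; last apply/eqP; rewrite /cl_proj -Quotient.idealrBE.
Qed.

Lemma cl_projB : {morph cl_proj : x y / x - y}.
Proof. by move=> x y; rewrite /cl_proj raddfB. Qed.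
Lemma cl_proj0 : cl_proj 0 = 0.
Proof. by rewrite /cl_proj raddf0. Qed.
Lemma cl_projD : {morph cl_proj : x y / x + y}.
Proof. by move=> x y; rewrite /cl_proj raddfD. Qed.

Lemma cl_proj_eqP phi psi :
  cl_proj phi = cl_proj psi <->
  forall chi, clim (ip phi chi) = clim (ip psi chi).
Proof.
rewrite cl_projP; split=> [/null_spaceP h chi|h].
  by have := h chi; rewrite ipDl ipNl climB => /eqP; rewrite subr_eq0 => /eqP.
by apply/null_spaceP => chi; rewrite ipDl ipNl climB h subrr.
Qed.

Lemma cl_repr_proj phi chi : clim (ip (cl_repr (cl_proj phi)) chi) = clim (ip phi chi).
Proof. by move: chi; apply/cl_proj_eqP; rewrite cl_reprK. Qed.

Definition cl_scale (c : Cx R) (u : cl_space) : cl_space :=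
  cl_proj (Cconst c *: cl_repr u).

(* The C[[lambda]]-action descends and factors through lambda = 0. *)
Lemma cl_projZ (z : Cx (fps R)) phi : cl_proj (z *: phi) = cl_scale (clim z) (cl_proj phi).
Proof.
apply/cl_proj_eqP => chi; rewrite !ipZl !climM cl_repr_proj !clim_conj.
by rewrite clim_const.
Qed.

Lemma cl_scaleA a b u : cl_scale a (cl_scale b u) = cl_scale (a * b) u.
Proof.
rewrite -[u]cl_reprK -{1}[b]clim_const -cl_projZ -{1}[a]clim_const -cl_projZ.
by rewrite scalerA cl_projZ climM !clim_const.
Qed.
Lemma cl_scale1 : left_id 1 cl_scale.
Proof.
move=> u; rewrite -[u]cl_reprK -[X in cl_scale X](_ : clim 1 = 1) -?cl_projZ ?scale1r //.
Qed.
Lemma cl_scaleDr : right_distributive cl_scale +%R.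
Proof.
move=> a u v; rewrite -[u]cl_reprK -[v]cl_reprK -cl_projD -{1 2 3}[a]clim_const.
by rewrite -!cl_projZ -cl_projD scalerDr.
Qed.
Lemma cl_scaleDl u : {morph cl_scale^~ u : a b / a + b}.
Proof.
move=> a b; rewrite -[u]cl_reprK -[a]clim_const -[b]clim_const -climD.
by rewrite -!cl_projZ -cl_projD scalerDl.
Qed.
HB.instance Definition _ := GRing.Zmodule_isLmodule.Build (Cx R) cl_space
  cl_scaleA cl_scale1 cl_scaleDr cl_scaleDl.

Definition cl_ip (u v : cl_space) : Cx R := clim (ip (cl_repr u) (cl_repr v)).

Lemma cl_ipE phi psi : cl_ip (cl_proj phi) (cl_proj psi) = clim (ip phi psi).
Proof.
rewrite /cl_ip cl_repr_proj (ip_herm (cl_repr _)) clim_conj cl_repr_proj.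
by rewrite -clim_conj -ip_herm.
Qed.

Lemma cl_ip_linr c u v w : cl_ip w (c *: u + v) = c * cl_ip w u + cl_ip w v.
Proof.
rewrite -[u]cl_reprK -[v]cl_reprK -[w]cl_reprK -[c]clim_const.
rewrite [_ *: _](_ : _ = cl_proj (Cconst c *: cl_repr u)); last first.
  by rewrite cl_projZ.
by rewrite -cl_projD !cl_ipE ip_linr climD climM.
Qed.
Lemma cl_ip_herm u v : cl_ip v u = conj (cl_ip u v).
Proof. by rewrite /cl_ip (ip_herm (cl_repr u)) clim_conj. Qed.

Lemma coef0_ge0 (x : fps R) : 0 <= x -> 0 <= coef x 0.
Proof.
rewrite le_eqVlt => /orP[/eqP<-//|/asboolP].
rewrite subr0 => -[[|r] [h pos]]; first exact: ltW.
by rewrite h.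
Qed.

Lemma cl_ip_ge0 u : Cx_ge0 (cl_ip u u).
Proof.
have [h1 h2] := ip_ge0 (cl_repr u).
by split; rewrite /cl_ip /= ?h1 //; exact: coef0_ge0.
Qed.

Lemma clim_ipZ (c d : Cx R) phi psi :
  clim (ip (Cconst c *: phi) (Cconst d *: psi)) =
  conj c * (d * clim (ip phi psi)).
Proof. by rewrite ipZl ipZr (climM (conj _)) (climM (Cconst d)) clim_conj !clim_const. Qed.

Lemma cl_ip_def u : cl_ip u u = 0 -> u = 0.
Proof.
rewrite -[u]cl_reprK; move: (cl_repr u) => x; rewrite cl_ipE => x0.
rewrite -cl_proj0; apply/cl_proj_eqP => y.
rewrite ip0l; set b := clim (ip x y); change (b = 0).
pose q : R := re (clim (ip y y)).
have q0 : 0 <= q by exact: coef0_ge0 (ip_ge0 y).2.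
have yy : clim (ip y y) = MkCx q 0.
  by apply: CxP => //=; rewrite (ip_ge0 y).1.
have yx : clim (ip y x) = conj b by rewrite (ip_herm x) clim_conj.
apply: (cs_algebra q0); rewrite -yy -yx /b.
set c := _ * clim _; set d := MkCx _ 0.
have := coef0_ge0 (ip_ge0 (Cconst c *: x + Cconst d *: y)).2.
set v := _ + _; suff : clim (ip v v) =
    conj c * (d * clim (ip x y)) + conj d * (c * clim (ip y x))
    + conj d * (d * clim (ip y y)) by move=> <-.
rewrite /v (ipDl _ (Cconst c *: x)) !ipDr !climD !clim_ipZ x0 !mulr0 add0r.
by rewrite addrA.
Qed.

Definition cl_preHilbert : preHilbert R :=
  PreHilbert cl_ip_linr cl_ip_herm cl_ip_ge0 cl_ip_def.

(* The projection, with values in the pre-Hilbert space. *)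
Definition clim_vec (phi : H) : cl_preHilbert := cl_proj phi.

Lemma clim_vec0 : clim_vec 0 = 0.
Proof. exact: cl_proj0. Qed.
Lemma clim_vec_lin (z : Cx (fps R)) phi psi :
  clim_vec (z *: phi + psi) = clim z *: clim_vec phi + clim_vec psi.
Proof. by rewrite /clim_vec cl_projD cl_projZ. Qed.

End ClassicalLimitSpace.

Arguments clim_vec {R H} phi.

Section ClassicalLimitFiltration.
Variables (R : realDomainType) (H : preHilbert (fps R)) (F : filtration H).

Lemma cl_submodule i : is_submodule (clim_vec @` F i).
Proof.
have [F0 FD] := fil_submodule i; split.
  by exists 0 => //; exact: clim_vec0.
move=> c _ _ [x Fx <-] [y Fy <-]; exists (Cconst c *: x + y); first exact: FD.
by rewrite clim_vec_lin clim_const.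
Qed.
Lemma cl_mono i j : fil_le i j ->
  clim_vec @` F i `<=` clim_vec @` F j.
Proof. by move=> ij _ [x /(fil_mono ij) Fx <-]; exists x. Qed.
Lemma cl_cover :
  \bigcup_i (clim_vec @` F i) = setT.
Proof.
apply/seteqP; split=> // u _.
have [i _ Fi] : (\bigcup_i F i) (cl_repr u) by rewrite fil_cover.
by exists i => //; exists (cl_repr u) => //; exact: cl_reprK.
Qed.

Definition cl_filtration : filtration (cl_preHilbert H) :=
  Filtration (@fil_refl _ _ F) (@fil_trans _ _ F) (@fil_directed _ _ F)
    cl_submodule cl_mono cl_cover.

End ClassicalLimitFiltration.

(* Main.v *)
(* A vector is killed by the classical limit iff it is orthogonal to everything  *)
(* modulo lambda, equivalently (Cauchy-Schwarz over R) iff its squared norm      *)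
(* vanishes modulo lambda. Adjointable maps preserve the first condition and     *)
(* isometries the second, so representations and intertwiners descend to the     *)
(* quotient. There [a] acts through its zeroth order only: the remaining terms   *)
(* are divisible by lambda, which acts by zero.                                  *)
From HB Require Import structures.
Require Import Defs.
From mathcomp Require Import all_boot all_order all_algebra.
From mathcomp Require Import boolp classical_sets.

Set Implicit Arguments.
Unset Strict Implicit.
Unset Printing Implicit Defensive.

Import Order.TTheory GRing.Theory Num.Theory.

Local Open Scope ring_scope.

(** Everything is descent along the surjection [clim_vec]. A linear map that sends null vectors to
    null vectors induces a linear map [cl_lin] of the quotients, determined by its values on classes
    ([cl_linE]). The operators of a representation qualify by [adjoint_null_preserving],
    intertwiners of every kind by [of_kind_null_preserving]. By [clim_rep] the induced operator sees
    only the zeroth order of the algebra element, so the original algebra acts. The identities,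
    functoriality and the three properties are then checked on lifts. *)

Section ClassicalLimitMap.
Variable R : realDomainType.
Implicit Types H K : preHilbert (fps R).

Lemma clim_vec_surj H (u : cl_preHilbert H) : exists phi, u = clim_vec phi.
Proof. by exists (cl_repr u); rewrite /clim_vec cl_reprK. Qed.

Lemma clim_vec_null H (phi : H) : clim_vec phi = 0 <-> phi \in @null_space _ H.
Proof. by rewrite -[X in _ = X]clim_vec0 /clim_vec cl_projP subr0. Qed.

Lemma clim_vec_sum H n (c : 'I_n -> Cx (fps R)) (v : 'I_n -> H) :
  clim_vec (\sum_(i < n) c i *: v i) = \sum_(i < n) clim (c i) *: clim_vec (v i).
Proof.
elim: n c v => [|n IH] c v; first by rewrite !big_ord0 clim_vec0.
by rewrite !big_ord_recl clim_vec_lin IH.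
Qed.

(** * Descent of adjointable and isometric maps to the quotients *)

Definition null_preserving H K (T : H -> K) : Prop :=
  forall phi, phi \in @null_space _ H -> T phi \in @null_space _ K.

Lemma adjoint_of_sym H K (T : {linear H -> K}) (S : {linear K -> H}) :
  adjoint_of T S -> adjoint_of S T.
Proof. by move=> TS x y; rewrite (ip_herm x) -TS -ip_herm. Qed.

Lemma adjoint_null_preserving H K (T : {linear H -> K}) (S : {linear K -> H}) :
  adjoint_of T S -> null_preserving T.
Proof.
move=> /adjoint_of_sym TS phi /null_spaceP phi0; apply/null_spaceP => psi.
by rewrite TS phi0.
Qed.

Lemma of_kind_null_preserving k H K (T : {linear H -> K}) :
  of_kind k T -> null_preserving T.
Proof.
case: k => /= [isoT phi /null_spaceP phi0|[S]|[S [+ _ _]]]; last 2 first.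
- exact: adjoint_null_preserving.
- exact: adjoint_null_preserving.
(* An isometry need not have an adjoint, so only the squared norm of [T phi] is controlled;
   definiteness of the form on the quotient of [K] turns this into nullity. *)
by apply/clim_vec_null/ip_def; rewrite /= /clim_vec cl_ipE isoT phi0.
Qed.

Section Descent.
Variables (H K : preHilbert (fps R)) (T : {linear H -> K}).

(** The proof of null preservation is an argument so that the linear structure can be inferred for
    the term [cl_fun nullT]. *)
Definition cl_fun of null_preserving T :=
  fun u : cl_preHilbert H => clim_vec (T (cl_repr u)) : cl_preHilbert K.

Variable nullT : null_preserving T.

(** The chosen representative differs from [phi] by a null vector, and [T] maps this difference to a
    null vector. *)
Lemma cl_funE phi : cl_fun nullT (clim_vec phi) = clim_vec (T phi).
Proof.
by apply/cl_projP; rewrite -linearB; apply/nullT/cl_projP/cl_reprK.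
Qed.

Lemma cl_fun_linear : linear (cl_fun nullT).
Proof.
move=> c u v; have [phi ->] := clim_vec_surj u; have [psi ->] := clim_vec_surj v.
by rewrite -[c]clim_const -clim_vec_lin !cl_funE linearP clim_vec_lin.
Qed.
HB.instance Definition _ := GRing.isLinear.Build (Cx R) (cl_preHilbert H)
  (cl_preHilbert K) *:%R (cl_fun nullT) cl_fun_linear.

Definition cl_lin : {linear cl_preHilbert H -> cl_preHilbert K} := cl_fun nullT.

Lemma cl_linE phi : cl_lin (clim_vec phi) = clim_vec (T phi).
Proof. exact: cl_funE. Qed.

End Descent.

Lemma cl_adjoint H K (T : {linear H -> K}) (S : {linear K -> H}) nullT nullS :
  adjoint_of T S -> adjoint_of (@cl_lin _ _ T nullT) (@cl_lin _ _ S nullS).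
Proof.
move=> TS u v; have [phi ->] := clim_vec_surj u; have [psi ->] := clim_vec_surj v.
by rewrite !cl_linE /= /clim_vec !cl_ipE TS.
Qed.

Lemma cl_cancel H K (T : {linear H -> K}) (S : {linear K -> H}) nullT nullS :
  cancel T S -> cancel (@cl_lin _ _ T nullT) (@cl_lin _ _ S nullS).
Proof. by move=> TK u; have [phi ->] := clim_vec_surj u; rewrite !cl_linE TK. Qed.

(** The adjoint of the limit is the limit of the adjoint [S], which itself descends because [T] is
    an adjoint of it. *)
Lemma cl_of_kind k H K (T : {linear H -> K}) (nullT : null_preserving T) :
  of_kind k T -> of_kind k (cl_lin nullT).
Proof.
case: k => /= [isoT u v|[S TS]|[S [TS TK SK]]].
- have [phi ->] := clim_vec_surj u; have [psi ->] := clim_vec_surj v.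
  by rewrite !cl_linE /clim_vec !cl_ipE isoT.
- have nullS := adjoint_null_preserving (adjoint_of_sym TS).
  by exists (cl_lin nullS); apply: cl_adjoint.
- have nullS := adjoint_null_preserving (adjoint_of_sym TS).
  exists (cl_lin nullS); split; first exact: cl_adjoint.
    exact: cl_cancel.
  exact: cl_cancel.
Qed.

End ClassicalLimitMap.

(** * The classical limit of a representation of the deformation *)

Section ClassicalLimitRep.
Variables (R : realDomainType) (A : starAlg R) (D : deformation A).

(** A section of [clim_alg]; in general it respects neither the deformed product nor the deformed
    involution. *)
Definition const_alg (a : A) : def_alg D := fps_const a : fps A.

Lemma clim_algK a : clim_alg (const_alg a) = a.
Proof. by []. Qed.

Lemma clim_alg_lin c (a b : def_alg D) :
  clim_alg (c *: a + b) = clim c *: clim_alg a + clim_alg b.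
Proof. by rewrite /clim_alg coefDE /= big_ord1. Qed.

Lemma clim_alg_mul (a b : def_alg D) :
  clim_alg (sa_mul a b) = sa_mul (clim_alg a) (clim_alg b).
Proof. by rewrite /clim_alg /= !big_ord1 def_mu0. Qed.

Lemma clim_alg_star (a : def_alg D) :
  clim_alg (sa_star a) = sa_star (clim_alg a).
Proof. by rewrite /clim_alg /= big_ord1 def_I0. Qed.

Definition lambda : Cx (fps R) := MkCx (MkFps (fun n => (n == 1%N)%:R)) 0.

Lemma lambda_factor (a : def_alg D) :
  clim_alg a = 0 -> exists b : def_alg D, a = lambda *: b.
Proof.
move=> a0; exists (MkFps (fun n => coef (a : fps A) n.+1) : fps A).
have coef0 : ccoef lambda 0 = 0 by [].
have coef1 : ccoef lambda 1 = 1 by [].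
have coefSS n : ccoef lambda n.+2 = 0 by [].
apply: fpsP => -[|n] /=; first by rewrite big_ord1 coef0 scale0r.
(* Only the term of index 1 survives, and it undoes the shift in the witness. *)
rewrite 2!big_ord_recl /= coef0 scale0r add0r coef1 scale1r subn1 /=.
by rewrite big1 ?addr0 // => i _; rewrite coefSS scale0r.
Qed.

Section Rep.
Variables (H : preHilbert (fps R)) (pi : starRep (def_alg D) H).

(** The difference of [a] and [b] is divisible by [lambda], and [lambda] acts by zero on the
    quotient. *)
Lemma clim_rep (a b : def_alg D) phi :
  clim_alg a = clim_alg b -> clim_vec (pi a phi) = clim_vec (pi b phi).
Proof.
move=> ab; have [d dE] : exists d : def_alg D, -1 *: b + a = lambda *: d.
  apply: lambda_factor; rewrite clim_alg_lin ab (_ : clim (-1) = -1).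
    by rewrite scaleN1r addNr.
  exact/CxP.
have -> : a = lambda *: d + b by rewrite -dE scaleN1r addrAC addNr add0r.
rewrite rep_lin clim_vec_lin (_ : clim lambda = 0) ?scale0r ?add0r //.
Qed.

Lemma rep_null_preserving a : null_preserving (pi a).
Proof. exact: adjoint_null_preserving (@rep_star _ _ _ pi a). Qed.

Definition cl_act (a : A) : {linear cl_preHilbert H -> cl_preHilbert H} :=
  cl_lin (@rep_null_preserving (const_alg a)).

Lemma cl_actE (a : def_alg D) phi :
  cl_act (clim_alg a) (clim_vec phi) = clim_vec (pi a phi).
Proof. by rewrite /cl_act cl_linE; apply: clim_rep. Qed.

Lemma cl_act_lin c a b u : cl_act (c *: a + b) u = c *: cl_act a u + cl_act b u.
Proof.
have [phi ->] := clim_vec_surj u; rewrite -(clim_algK a) -(clim_algK b).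
by rewrite -[c]clim_const -clim_alg_lin !cl_actE rep_lin clim_vec_lin.
Qed.

Lemma cl_act_mul a b u : cl_act (sa_mul a b) u = cl_act a (cl_act b u).
Proof.
have [phi ->] := clim_vec_surj u; rewrite -(clim_algK a) -(clim_algK b).
(* The deformed product of the constant lifts need not be constant, but [cl_actE] accepts any lift
   of the product. *)
by rewrite -clim_alg_mul !cl_actE rep_mul.
Qed.

Lemma cl_act_star a : adjoint_of (cl_act a) (cl_act (sa_star a)).
Proof.
move=> u v; have [phi ->] := clim_vec_surj u; have [psi ->] := clim_vec_surj v.
rewrite -(clim_algK a) -clim_alg_star !cl_actE /= /clim_vec !cl_ipE.
by rewrite rep_star.
Qed.

Definition cl_rep : starRep A (cl_preHilbert H) :=
  StarRep cl_act_lin cl_act_mul cl_act_star.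

Lemma cl_repE (a : def_alg D) phi :
  cl_rep (clim_alg a) (clim_vec phi) = clim_vec (pi a phi).
Proof. exact: cl_actE. Qed.

(** A decomposition of a lift projects term by term, its coefficients being replaced by their zeroth
    orders. *)
Lemma cl_strongly_nondegenerate :
  strongly_nondegenerate pi -> strongly_nondegenerate cl_rep.
Proof.
move=> snd; apply/seteqP; split=> // u _; have [phi ->] := clim_vec_surj u.
have : [set: H]%classic phi by [].
rewrite -snd => -[n [c [v [vE ->]]]].
exists n, (fun i => clim (c i)), (fun i => clim_vec (v i)).
split=> [i|]; last exact: clim_vec_sum.
have [a [psi ->]] := vE i.
by exists (clim_alg a), (clim_vec psi); rewrite cl_repE.
Qed.

Lemma cl_compatible (F : filtration H) :
  compatible pi F -> compatible cl_rep (cl_filtration F).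
Proof.
move=> cF i a _ [phi Fphi <-]; exists (pi (const_alg a) phi); first exact: cF.
by rewrite -cl_repE clim_algK.
Qed.

Lemma cl_pseudo_cyclic_vectors (F : filtration H) (Omega : fil_idx F -> H) :
  pseudo_cyclic_vectors pi Omega ->
  pseudo_cyclic_vectors cl_rep (F := cl_filtration F)
    (fun i => clim_vec (Omega i)).
Proof.
move=> cyc i; have [FO cycO] := cyc i; split; first by exists (Omega i).
move=> _ [psi Fpsi <-]; have [a ->] := cycO _ Fpsi.
by exists (clim_alg a); rewrite cl_repE.
Qed.

End Rep.

Definition cl_ob (X : repr_ob (def_alg D)) : repr_ob A :=
  ReprOb (cl_rep (rob_rep X)).

(** * Intertwiners and functoriality *)

Section Intertwiner.
Variables (k : morphism_kind) (X Y : repr_ob (def_alg D)).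
Variable T : intertwiner k X Y.

Definition cl_int_lin := cl_lin (of_kind_null_preserving (int_kind T)).

Lemma cl_int_comm a u :
  cl_int_lin (cl_rep (rob_rep X) a u) = cl_rep (rob_rep Y) a (cl_int_lin u).
Proof.
have [phi ->] := clim_vec_surj u; rewrite -(clim_algK a).
rewrite (cl_repE (rob_rep X)) /cl_int_lin cl_linE int_comm cl_linE.
exact/esym/cl_repE.
Qed.

Definition cl_int : intertwiner k (cl_ob X) (cl_ob Y) :=
  @Intertwiner k R A (cl_ob X) (cl_ob Y) cl_int_lin cl_int_comm
    (cl_of_kind _ (int_kind T)).

Lemma cl_intE phi : cl_int (clim_vec phi) = clim_vec (T phi).
Proof. exact: cl_linE. Qed.

End Intertwiner.

(** Intertwiners are equal when they agree on vectors, and every vector of the limit is a class,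
    where [cl_intE] computes both sides. *)
Lemma cl_int_functor k :
  is_functor (C := rep_cat k (def_alg D)) (D := rep_cat k A) (@cl_int k).
Proof.
split=> [X|X Y Z S T]; apply: intertwiner_inj => u.
  have [phi ->] := @clim_vec_surj _ (rob_space X) u; exact: cl_intE.
have [phi ->] := @clim_vec_surj _ (rob_space X) u.
rewrite cl_intE; apply/esym.
exact: etrans (congr1 (cl_int S) (cl_intE T phi)) (cl_intE S _).
Qed.

End ClassicalLimitRep.

Theorem proposition8p5 (R : realDomainType) (A : starAlg R)
    (D : deformation A) :
  exists clrep : forall H : preHilbert (fps R),
      starRep (def_alg D) H -> starRep A (cl_preHilbert H),
    (forall (H : preHilbert (fps R)) (pi : starRep (def_alg D) H)
            (a : def_alg D) (phi : H),
       clrep H pi (clim_alg a) (clim_vec phi) = clim_vec (pi a phi)) /\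
    (forall k : morphism_kind,
       let clob := fun X : repr_ob (def_alg D) =>
         ReprOb (clrep (rob_space X) (rob_rep X)) in
       exists clmap : forall X Y : repr_ob (def_alg D),
           intertwiner k X Y -> intertwiner k (clob X) (clob Y),
         is_functor (C := rep_cat k (def_alg D)) (D := rep_cat k A) clmap /\
         (forall (X Y : repr_ob (def_alg D)) (T : intertwiner k X Y)
                 (phi : rob_space X),
            clmap X Y T (clim_vec phi) = clim_vec (T phi))) /\
    (forall (H : preHilbert (fps R)) (pi : starRep (def_alg D) H),
       (strongly_nondegenerate pi -> strongly_nondegenerate (clrep H pi)) /\
       (filtered pi -> filtered (clrep H pi)) /\
       (forall F : filtration H,
          compatible pi F -> compatible (clrep H pi) (cl_filtration F)) /\
       (pseudo_cyclic pi -> pseudo_cyclic (clrep H pi)) /\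
       (forall (F : filtration H) (Omega : fil_idx F -> H),
          pseudo_cyclic_vectors pi Omega ->
          pseudo_cyclic_vectors (clrep H pi) (F := cl_filtration F)
            (fun i => clim_vec (Omega i)))).
Proof.
exists (fun H pi => cl_rep pi); split; first by move=> H pi; apply: cl_repE.
split=> [k|H pi].
  exists (@cl_int R A D k); split; first exact: cl_int_functor.
  by move=> X Y T; apply: cl_intE.
split; first exact: cl_strongly_nondegenerate.
split; first by move=> [F /cl_compatible]; exists (cl_filtration F).
split; first exact: cl_compatible.
split; last exact: cl_pseudo_cyclic_vectors.
move=> [F [Omega /cl_pseudo_cyclic_vectors cyc]].
by exists (cl_filtration F); eexists; exact: cyc.
Qed.
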